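(* Let $G=(V,E)$ be a finite simple directed graph that is transitive and acyclic. Then a set $M\subseteq V$ is a strong module of $G$ if and only if $M$ is a strong module of the undirected closure $\mathcal{U}(G)=(V,E\cup E^{-1})$, where $E^{-1}=\{(b,a)\mid (a,b)\in E\}$.
   Context: All graphs are simple (no loops, no multiple edges) and directed; an undirected graph is a directed graph with $E=E^{-1}$ (each undirected edge is a pair of opposite arcs). A graph $G=(V,E)$ is transitive iff for all $(a,b),(b,c)\in E$ with $a\neq c$ we have $(a,c)\in E$. A module of $G$ is a non-empty set $M\subseteq V$ such that every vertex $x\in V\setminus M$ has the same relationship to all vertices of $M$, i.e. for all $m,m'\in M$: $(x,m)\in E\iff(x,m')\in E$ and $(m,x)\in E\iff(m',x)\in E$. Two modules overlap if they intersect but neither contains the other. A module is strong if it overlaps with no module of the same graph. *)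

(* Defs.v *)
(* A finite directed graph on a finType [V] is given by its
   arc relation [e : rel V], simple meaning [irreflexive e]; opposite arcs
   [e x y] and [e y x] may both be present. *)
From mathcomp Require Import all_boot.

Set Implicit Arguments.
Unset Strict Implicit.
Unset Printing Implicit Defensive.

(* Weaker than [ssrbool.transitive]: opposite arcs do not force loops. *)
Definition graph_transitive (V : finType) (e : rel V) : Prop :=
  forall a b c : V, e a b -> e b c -> a != c -> e a c.

(* [ucycle] also accepts the empty sequence; a pair of opposite arcs is a
   directed cycle of length two. *)
Definition acyclic (V : finType) (e : rel V) : Prop :=
  forall c : seq V, ucycle e c -> c = [::].

Definition undirected_closure (V : finType) (e : rel V) : rel V :=
  [rel x y | e x y || e y x].

Definition is_module (V : finType) (e : rel V) (M : {set V}) : Prop :=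
  M != set0 /\
  forall x : V, x \notin M ->
    forall m m' : V, m \in M -> m' \in M ->
      (e x m <-> e x m') /\ (e m x <-> e m' x).

Definition overlap (V : finType) (A B : {set V}) : bool :=
  [&& A :&: B != set0, ~~ (A \subset B) & ~~ (B \subset A)].

Definition strong_module (V : finType) (e : rel V) (M : {set V}) : Prop :=
  is_module e M /\
  forall N : {set V}, is_module e N -> ~~ overlap M N.

(* Main.v *)
(* The graph is a strict order e, and its undirected closure H is the
   comparability graph of e. Every module of e is a module of H. Conversely, for
   a module N of H, adding to N the vertices lying both above some vertex of N
   and below another one yields a module of e.
   If M is a strong module of H and x is such an added vertex outside M, then
   the part of M below x, together with all the added vertices outside M, is a
   module of H overlapping M; so nothing is added and M is a module of e.
   If M is a strong module of e and N is a module of H overlapping M, the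
   completion of N contains M, so M :&: N and M :\: N are completely comparable
   and M is a linear sum of two nonempty parts; all of N :\: M is above or below
   M, say some u is above. The top part of M, together with the vertices above M
   that belong to N or are below some vertex of N :\: M above M, is a module of e
   overlapping M. *)
Require Import Defs.
From mathcomp Require Import all_boot.

Set Implicit Arguments.
Unset Strict Implicit.
Unset Printing Implicit Defensive.

Arguments undirected_closure /.

(** * Overlaps, modules and converses *)

Lemma overlapP (V : finType) (A B : {set V}) :
  reflect [/\ exists x, x \in A /\ x \in B,
              exists x, x \in A /\ x \notin B &
              exists x, x \in B /\ x \notin A] (overlap A B).
Proof.
apply: (iffP and3P) => [[/set0Pn[x] /setIP[xA xB] /subsetPn[y yA yB] /subsetPn[z zB zA]]|].
  by split; [exists x | exists y | exists z].
move=> [[x [xA xB]] [y [yA yB]] [z [zB zA]]]; split.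
- by apply/set0Pn; exists x; rewrite inE xA.
- by apply/subsetPn; exists y.
- by apply/subsetPn; exists z.
Qed.

(** The case [a = c], which [graph_transitive] leaves open, would make [[:: a; b]] a directed cycle
    of length two. *)
Lemma transitive_of_acyclic (V : finType) (e : rel V) :
  irreflexive e -> graph_transitive e -> acyclic e -> transitive e.
Proof.
move=> irr tr acy b a c ab bc.
have [ac|] := eqVneq a c; last exact: tr ab bc.
move: bc; rewrite -ac => ba.
have := acy [:: a; b]; rewrite /ucycle /= ab ba inE.
have [E|_] := eqVneq a b; first by move: ab; rewrite E irr.
by move=> /(_ isT).
Qed.

Lemma module_closure (V : finType) (e : rel V) (M : {set V}) :
  is_module e M -> is_module (undirected_closure e) M.
Proof.
move=> [M0 modM]; split=> // x xM m m' mM m'M.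
have [[h1 h2] [h3 h4]] := modM x xM m m' mM m'M.
by split; split=> /orP[] h; apply/orP; auto.
Qed.

Lemma module_converse (V : finType) (e : rel V) (M : {set V}) :
  is_module e M -> is_module (fun x y => e y x) M.
Proof.
move=> [M0 modM]; split=> // x xM m m' mM m'M.
by have [] := modM x xM m m' mM m'M.
Qed.

(** The closure of the converse is, by computation, the converse of the closure. This supports the
    order duality used at the end. *)
Lemma closure_converse_module (V : finType) (e : rel V) (M : {set V}) :
  is_module (undirected_closure e) M ->
  is_module (undirected_closure (fun x y => e y x)) M.
Proof. exact: module_converse. Qed.

Lemma closure_sym (V : finType) (e : rel V) : symmetric (undirected_closure e).
Proof. by move=> x y; rewrite /= orbC. Qed.

Lemma closure_moduleI (V : finType) (e : rel V) (N : {set V}) :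
  N != set0 ->
  (forall x, x \notin N ->
     {in N, forall n, undirected_closure e x n} \/
     {in N, forall n, ~~ undirected_closure e x n}) ->
  is_module (undirected_closure e) N.
Proof.
move=> N0 modN; split=> // x xN m m' mN m'N.
rewrite !(closure_sym e _ x).
by have [h|h] := modN x xN; have := h m mN; have := h m' m'N;
  [move=> -> -> | move=> /negbTE -> /negbTE ->].
Qed.

Lemma closure_moduleW (V : finType) (e : rel V) (N : {set V}) x n n' :
  is_module (undirected_closure e) N -> x \notin N -> n \in N -> n' \in N ->
  undirected_closure e x n -> undirected_closure e x n'.
Proof. by move=> [_ modN] xN nN n'N; have [[]] := modN x xN n n' nN n'N. Qed.

(** * Modules of a strict order *)

Section StrictOrder.

Variables (V : finType) (e : rel V).
Hypotheses (irr : irreflexive e) (tr : transitive e).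

Local Notation cmp := (undirected_closure e).

Lemma strict_asym x y : e x y -> e y x = false.
Proof. by move=> xy; apply/negP => yx; move: (tr xy yx); rewrite irr. Qed.

Lemma moduleI (M : {set V}) :
  M != set0 ->
  (forall x, x \notin M ->
     [\/ {in M, forall m, e x m}, {in M, forall m, e m x} |
         {in M, forall m, ~~ cmp x m}]) ->
  is_module e M.
Proof.
move=> M0 modM; split=> // x xM m m' mM m'M.
have [h|h|h] := modM x xM.
- by rewrite !(strict_asym (h _ _)) ?h.
- by rewrite !(strict_asym (h _ _)) ?h.
- by have /norP[/negbTE -> /negbTE ->] := h m mM;
    have /norP[/negbTE -> /negbTE ->] := h m' m'M.
Qed.

Lemma module_cases (M : {set V}) x :
  is_module e M -> x \notin M ->
  [\/ {in M, forall m, e x m}, {in M, forall m, e m x} |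
      {in M, forall m, ~~ cmp x m}].
Proof.
move=> [/set0Pn[m mM] modM] xM.
have h m' (m'M : m' \in M) := modM x xM m m' mM m'M.
have [xm|nxm] := boolP (e x m).
  by constructor 1 => m' /h [[+ _] _]; apply.
have [mx|nmx] := boolP (e m x).
  by constructor 2 => m' /h [_ [+ _]]; apply.
constructor 3 => m' /h [[_ h1] [_ h2]].
by apply/norP; split; [apply: contra nxm | apply: contra nmx].
Qed.

(** * Order-convex hulls of modules of the comparability graph *)

Definition between (N : {set V}) : {set V} :=
  [set x | [exists a in N, e a x] && [exists b in N, e x b]].

Lemma betweenP (N : {set V}) x :
  reflect (exists a b, [/\ a \in N, b \in N, e a x & e x b]) (x \in between N).
Proof.
rewrite inE; apply: (iffP andP).
  by move=> [/exists_inP[a aN ax] /exists_inP[b bN xb]]; exists a, b.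
by move=> [a [b [aN bN ax xb]]]; split; apply/exists_inP; [exists a | exists b].
Qed.

(** A vertex outside the hull is comparable to all of [N] or to none of it. If to all, then always
    on the same side, since otherwise it would lie between two elements of [N]. Transitivity carries
    each case over to [between N]. *)
Lemma completion_module (N : {set V}) :
  is_module cmp N -> is_module e (N :|: between N).
Proof.
move=> modN; have [/set0Pn[n nN] _] := modN.
apply: moduleI; first by apply/set0Pn; exists n; rewrite inE nN.
move=> y /[!in_setU] /norP[yN yB].
have [yn|nyn] := boolP (cmp y n); last first.
  have ncmp m : m \in N -> ~~ cmp y m.
    by move=> mN; apply: contra nyn; apply: closure_moduleW modN yN mN nN.
  constructor 3 => x /[!in_setU] /orP[/ncmp //|].
  move=> /betweenP[a [b [aN bN ax xb]]]; apply/norP; split.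
  - by apply: contra (ncmp b bN) => yx; rewrite /= (tr yx xb).
  - by apply: contra (ncmp a aN) => xy; rewrite /= (tr ax xy) orbT.
have ycmp m : m \in N -> cmp y m.
  by move=> mN; apply: closure_moduleW modN yN nN mN yn.
have [yltn|/negbTE nyltn] := boolP (e y n).
  have low m : m \in N -> e y m.
    move=> mN; have /orP[//|my] := ycmp m mN.
    by case/negP: yB; apply/betweenP; exists m, n.
  constructor 1 => x /[!in_setU] /orP[/low //|].
  by move=> /betweenP[a [b [aN bN ax xb]]]; apply: tr ax; apply: low.
have nlty : e n y by move: yn; rewrite /= nyltn.
have high m : m \in N -> e m y.
  move=> mN; have /orP[ym|//] := ycmp m mN.
  by case/negP: yB; apply/betweenP; exists n, m.
constructor 2 => x /[!in_setU] /orP[/high //|].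
by move=> /betweenP[a [b [aN bN ax xb]]]; apply: tr xb _; apply: high.
Qed.

Lemma strong_closure_module (M : {set V}) :
  strong_module cmp M -> is_module e M.
Proof.
move=> [modM strM]; have modC := completion_module modM.
suff BM : between M \subset M by move: modC; rewrite (setUidPl BM).
apply/subsetP => x xB; apply/negPn/negP => xM.
have [a [b [aM bM ax xb]]] := betweenP _ _ xB.
have Bcmp y m : y \in between M -> y \notin M -> m \in M -> cmp y m.
  move=> /betweenP[c [d [cM dM cy yd]]] yM mM.
  by apply: closure_moduleW modM yM dM mM _; rewrite /= yd.
pose N := [set m in M | e m x] :|: between M :\: M.
have ov : overlap M N.
  apply/overlapP; split.
  - by exists a; rewrite aM !inE aM ax.
  - by exists b; rewrite bM !in_setU in_setD bM inE (strict_asym xb) andbF.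
  - by exists x; rewrite !in_setU in_setD xM xB orbT.
suff /strM : is_module cmp N by rewrite ov.
apply: closure_moduleI; first by apply/set0Pn; exists a; rewrite !inE aM ax.
move=> y; rewrite in_setU in_setD inE => /norP[yL yB].
(* Inside [M], a vertex that is not below [x] is above it, hence above the whole lower part of [N].
   Outside the hull of [M], uniformity is inherited from the hull, which contains [N]. *)
have [yM|yM] := boolP (y \in M).
  left=> n; rewrite in_setU in_setD inE => /orP[/andP[nM nx]|/andP[nM nB]].
    have /orP[xy|yx] := Bcmp x y xB xM yM; last by rewrite yM yx in yL.
    by rewrite /= (tr nx xy) orbT.
  by rewrite closure_sym; apply: Bcmp.
have yC : y \notin M :|: between M.
  by rewrite in_setU; apply/norP; split=> //; rewrite yM in yB.
have NC n : n \in N -> n \in M :|: between M.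
  rewrite !in_setU in_setD inE => /orP[/andP[-> //]|/andP[_ ->]].
  by rewrite orbT.
have [h|h|h] := module_cases modC yC.
- by left=> n /NC /h /= ->.
- by left=> n /NC /h /= ->; rewrite orbT.
- by right=> n /NC /h.
Qed.

(** * Linear sums and the overlapping module built from one *)

Lemma series_cut (A B : {set V}) a b :
  a \in A -> b \in B -> {in A & B, forall x y, cmp x y} ->
  exists T : {set V},
    [/\ T \subset A :|: B, T != set0, exists2 s, s \in A :|: B & s \notin T &
        forall s t, s \in A :|: B -> s \notin T -> t \in T -> e s t].
Proof.
wlog ab : A B a b / e a b.
  move=> W aA bB AB; have /orP[ab|ba] := AB a b aA bB; first exact: (W A B a b).
  rewrite setUC; apply: (W B A b a) => // x y xB yA.
  by rewrite closure_sym AB.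
move=> aA bB AB.
(* With [L] the part of [A] below [b], the complement of [T] in the union consists of [L] and the
   elements of [B] below some element of [L]. Hence it lies entirely below [T]; [a] is in it and [b]
   is in [T]. *)
pose T := [set m in A | e b m] :|:
          [set m in B | [forall x in A, e x b ==> e x m]].
have inT m : (m \in T) =
    (m \in A) && e b m || (m \in B) && [forall x in A, e x b ==> e x m].
  by rewrite !inE.
have AnB x : x \in A -> x \in B -> False.
  by move=> xA xB; have := AB x x xA xB; rewrite /= irr.
exists T; split.
- by apply/subsetP => m; rewrite inT inE => /orP[] /andP[->]; rewrite ?orbT.
- apply/set0Pn; exists b; rewrite inT bB /=; apply/orP; right.
  by apply/forall_inP => x _; apply/implyP.
- exists a; first by rewrite inE aA.
  by rewrite inT (strict_asym ab) andbF /=; apply/andP => -[/(AnB a aA)].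
move=> s t sAB; rewrite !inT => /norP[sA sB] tT.
have below_b x : x \in A -> ~~ e b x -> e x b.
  by move=> xA nbx; have /orP[//|bx] := AB x b xA bB; rewrite bx in nbx.
move: sAB; rewrite inE => /orP[{sB}sA'|{sA}sB'].
  rewrite sA' /= in sA; have sb := below_b s sA' sA.
  case/orP: tT => /andP[_]; first exact: tr.
  by move/forall_inP => /(_ s sA') /implyP; apply.
move: sB; rewrite sB' /= => /forall_inPn[x xA]; rewrite negb_imply => /andP[xb nxs].
have sx : e s x by have /orP[xs|//] := AB x s xA sB'; rewrite xs in nxs.
case/orP: tT => /andP[_]; first by apply: tr; apply: tr sx xb.
by move/forall_inP => /(_ x xA) /implyP /(_ xb); apply: tr.
Qed.

Lemma top_overlap (M N : {set V}) u :
  is_module e M -> is_module cmp N -> overlap M N ->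
  {in M :&: N & M :\: N, forall x y, cmp x y} ->
  u \in N -> u \notin M -> {in M, forall m, e m u} ->
  exists Q, is_module e Q /\ overlap M Q.
Proof.
move=> modM modN /overlapP[[a [aM aN]] [b [bM bN]] _] AB uN uM Mu.
have aA : a \in M :&: N by rewrite inE aM.
have bB : b \in M :\: N by rewrite inE bN.
have [T []] := series_cut aA bB AB.
rewrite setID => /subsetP TM /set0Pn[t tT] [s sM sT] cut.
(* Since [b] is comparable to [a] and [N] is a module of the closure, [b] is comparable to [z]
   too. *)
have NM z : z \in N -> z \notin M ->
    {in M, forall m, e m z} \/ {in M, forall m, e z m}.
  move=> zN zM; have [h|h|/(_ b bM)] := module_cases modM zM; [by right|by left|].
  rewrite closure_sym (closure_moduleW modN bN aN zN) //.
  by rewrite closure_sym AB.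
pose above z := [forall m in M, e m z].
(* Closing downwards among the vertices above [M] ensures that a vertex above [M] but outside [Y] is
   not below any such [v]; if comparable to [N], it must then be above [v]. *)
pose Y := [set w | above w &&
  ((w \in N) || [exists v in N :\: M, above v && e w v])].
have YM w : w \in Y -> {in M, forall m, e m w}.
  by rewrite inE => /andP[/forall_inP].
have uY : u \in Y by rewrite inE uN andbT; apply/forall_inP.
exists (T :|: Y); split; last first.
  apply/overlapP; split.
  - by exists t; rewrite in_setU tT TM.
  - exists s; rewrite in_setU sM; split=> //; apply/norP; split=> //.
    by apply/negP => /YM /(_ s sM); rewrite irr.
  - by exists u; rewrite in_setU uY orbT.
apply: moduleI; first by apply/set0Pn; exists t; rewrite in_setU tT.
move=> z; rewrite in_setU => /norP[zT zY].
have [zM|zM] := boolP (z \in M).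
  constructor 1 => q /[!in_setU] /orP[/cut|/YM]; [exact|exact].
have [zltM|Mltz|zM_inc] := module_cases modM zM.
- constructor 1 => q /[!in_setU] /orP[/TM/zltM //|/YM /(_ t (TM t tT))].
  exact: tr (zltM t (TM t tT)).
- have az : above z by apply/forall_inP.
  move: zY; rewrite inE az /= => /norP[zN nzv].
  have above_v v : v \in N -> v \notin M -> above v -> e v z.
    move=> vN vM av.
    have : cmp z v.
      by apply: closure_moduleW modN zN aN vN _; rewrite /= (Mltz a aM) orbT.
    case/orP=> // zv; case/negP: nzv.
    by apply/exists_inP; exists v; rewrite ?av // inE vM.
  constructor 2 => q /[!in_setU] /orP[/TM/Mltz //|qY].
  have qM : q \notin M by apply/negP => qM; move: (YM q qY q qM); rewrite irr.
  move: qY; rewrite inE => /andP[aq /orP[qN|]]; first exact: above_v.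
  move=> /exists_inP[v /setDP[vN vM] /andP[av qv]].
  exact: tr qv (above_v v vN vM av).
- have zN : z \notin N.
    apply/negP => zN; have := zM_inc a aM.
    by have [h|h] := NM z zN zM; rewrite /= h ?orbT.
  have N_inc v : v \in N -> ~~ cmp z v.
    by move=> vN; apply: contra (zM_inc a aM); apply: closure_moduleW modN zN vN aN.
  constructor 3 => q /[!in_setU] /orP[/TM/zM_inc //|qY].
  have aq := YM q qY a aM.
  move: qY; rewrite inE => /andP[_ /orP[/N_inc //|]].
  move=> /exists_inP[v /setDP[vN _] /andP[_ qv]].
  (* Here [a] is below [q] and [q] below [v], so comparability of [z] with [q] would make [z]
     comparable to [v] or to [a]. *)
  apply/norP; split; apply/negP => h.
    by have := N_inc v vN; rewrite /= (tr h qv).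
  by have := zM_inc a aM; rewrite /= (tr aq h) orbT.
Qed.

End StrictOrder.

(** * Transfer of strength and conclusion *)

Lemma strong_module_closure (V : finType) (e : rel V) (M : {set V}) :
  irreflexive e -> transitive e ->
  strong_module e M -> strong_module (undirected_closure e) M.
Proof.
move=> irr tr [modM strM]; split; first exact: module_closure.
move=> N modN; apply/negP => ov.
have /overlapP[[a [aM aN]] [b [bM bN]] [u [uN uM]]] := ov.
have modC := completion_module irr tr modN.
have MC : M \subset N :|: between e N.
  apply/negPn/negP => /subsetPn[x xM xC].
  case/negP: (strM _ modC); apply/overlapP; split.
  - by exists a; rewrite in_setU aN.
  - by exists x.
  - by exists u; rewrite in_setU uN.
(* An element of [M] outside [N] lies between elements of [N], so it is comparable to one of them
   and hence to all. *)
have AB : {in M :&: N & M :\: N, forall x y, undirected_closure e x y}.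
  move=> x y /setIP[xM xN] /setDP[yM yN].
  have := subsetP MC y yM; rewrite in_setU (negbTE yN) orFb.
  move=> /betweenP[c [d [cN dN cy yd]]].
  by rewrite closure_sym (closure_moduleW modN yN dN xN) //= yd.
have [uM_lt|Mu|/(_ b bM)] := module_cases modM uM.
(* When [u] is below [M], the construction is applied to the reversed order, which has the same
   modules. *)
- have tr' : transitive (fun x y => e y x) by move=> y x z yx zy; apply: tr zy yx.
  have AB' : {in M :&: N & M :\: N,
      forall x y, undirected_closure (fun x y => e y x) x y}.
    by move=> x y xA yB; rewrite /= orbC; apply: AB.
  have [Q [/module_converse modQ]] := @top_overlap _ (fun x y => e y x) irr tr' _ _ _
    (module_converse modM) (closure_converse_module modN) ov AB' uN uM uM_lt.
  exact/negP/strM.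
- have [Q [modQ]] := top_overlap irr tr modM modN ov AB uN uM Mu.
  exact/negP/strM.
- rewrite closure_sym (closure_moduleW modN bN aN uN) //.
  by rewrite closure_sym AB // inE ?aM ?bN.
Qed.

Theorem theorem1 (V : finType) (e : rel V)
  (e_simple : irreflexive e)
  (e_trans : graph_transitive e)
  (e_acyclic : acyclic e)
  (M : {set V}) :
  strong_module e M <-> strong_module (undirected_closure e) M.
Proof.
have tr := transitive_of_acyclic e_simple e_trans e_acyclic.
split=> [|strM]; first exact: strong_module_closure.
split; first exact: strong_closure_module.
by move=> N /module_closure; apply: (proj2 strM).
Qed.
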